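(* Let $\Omega\subset\mathbb{R}^n$ be open, $\omega\in A_\infty$, and let $p:\Omega\to[1,\infty]$ be measurable such that $\frac1p$ satisfies the log-Hölder decay condition with limit exponent $p_\infty\in[1,\infty]$. Then there exists $\lambda\in(0,1)$ such that \[\int_\Omega\lambda^{1/\left|\frac1{p(x)}-\frac1{p_\infty}\right|}\,\omega(x)\,dx<\infty.\]
   Context: Convention $1/\infty:=0$ (and $\lambda^{1/0}:=0$ for $\lambda\in(0,1)$). $\frac1p$ satisfies the log-Hölder decay condition with $p_\infty$ if there is $c_2>0$ with $\big|\frac1{p(x)}-\frac1{p_\infty}\big|\le\frac{c_2}{\log(e+|x|)}$ for all $x\in\Omega$. A weight is a nonnegative locally integrable function $\omega$ on $\mathbb{R}^n$, $\omega(E):=\int_E\omega\,dx$. For $1<q<\infty$, $\omega\in A_q$ means $\sup_B|B|^{-q}\omega(B)\big(\int_B\omega^{-q'/q}dx\big)^{q-1}<\infty$ with $1/q+1/q'=1$, supremum over open balls; $\omega\in A_1$ means $M\omega\le C\omega$ a.e. ($M$ the Hardy–Littlewood maximal operator); $A_\infty:=\bigcup_{q\in[1,\infty)}A_q$. *)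

(* Defs.v *)
From HB Require Import structures.
From mathcomp Require Import all_boot all_order all_algebra.
From mathcomp Require Import all_classical all_reals all_analysis.
From mathcomp Require Import measurable_realfun.
Set Implicit Arguments. Unset Strict Implicit. Unset Printing Implicit Defensive.
Import Order.TTheory GRing.Theory Num.Theory.
Local Open Scope classical_set_scope.
Local Open Scope ring_scope.

Section product_sigma_finite.
(* The generic sigma-finite instance of the library for [m1 \x m2] is shadowed
   by a later canonical declaration, so we re-declare it on a wrapper. *)
Local Open Scope ereal_scope.
Context (d1 d2 : measure_display) (T1 : measurableType d1)
  (T2 : measurableType d2) (R : realType).
Variables (m1 : {sigma_finite_measure set T1 -> \bar R})
  (m2 : {sigma_finite_measure set T2 -> \bar R}).

Definition pmeas : set (T1 * T2) -> \bar R := (m1 \x m2)%E.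
HB.instance Definition _ := Measure.on pmeas.

Lemma pmeas_sigma_finite : sigma_finite setT pmeas.
Proof.
have /sigma_finiteP[F [TF ndF Foo]] := sigma_finiteT m1.
have /sigma_finiteP[G [TG ndG Goo]] := sigma_finiteT m2.
exists (fun n => F n `*` G n).
 rewrite -setXTT TF TG predeqE => -[x y]; split.
    move=> [/= [n _ Fnx] [k _ Gky]]; exists (maxn n k) => //; split.
    - by move: x Fnx; exact/subsetPset/ndF/leq_maxl.
    - by move: y Gky; exact/subsetPset/ndG/leq_maxr.
  by move=> [n _ []/= ? ?]; split; exists n.
move=> k; have [? ?] := Foo k; have [? ?] := Goo k.
split; first exact: measurableX.
by rewrite /pmeas product_measure1E// lte_mul_pinfty// ge0_fin_numE.
Qed.

HB.instance Definition _ := Measure_isSigmaFinite.Build _ _ _ pmeas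
  pmeas_sigma_finite.
End product_sigma_finite.

Record mspace (R : realType) := MSpace {
  ms_disp : measure_display;
  ms_T :> measurableType ms_disp;
  ms_mu : {sigma_finite_measure set ms_T -> \bar R} }.

Definition Rn0 (R : realType) : mspace R :=
  @MSpace R _ unit (SigmaFiniteMeasure.clone _ _ _ (\d_tt)%R _).

Definition RnS (R : realType) (M : mspace R) : mspace R :=
  @MSpace R _ (measurableTypeR R * ms_T M)%type
   (pmeas lebesgue_measure (ms_mu M)).

Fixpoint Rn (R : realType) (n : nat) : mspace R :=
  match n with 0 => Rn0 R | m.+1 => RnS (Rn R m) end.

Definition pt (R : realType) n := ms_T (Rn R n).
Definition leb (R : realType) n : set (pt R n) -> \bar R := ms_mu (Rn R n).

Fixpoint sqnorm (R : realType) (n : nat) : pt R n -> R :=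
  match n return pt R n -> R with
  | 0 => fun _ => 0
  | m.+1 => fun x => x.1 ^+ 2 + sqnorm x.2
  end.

Fixpoint vsub (R : realType) (n : nat) : pt R n -> pt R n -> pt R n :=
  match n return pt R n -> pt R n -> pt R n with
  | 0 => fun x _ => x
  | m.+1 => fun x y => (x.1 - y.1, vsub x.2 y.2)
  end.

Section Euclid.
Variables (R : realType) (n : nat).
Local Open Scope ereal_scope.

Definition enorm (x : pt R n) : R := Num.sqrt (sqnorm x).
Definition edist (x y : pt R n) : R := enorm (vsub x y).
Definition eball (c : pt R n) (r : R) : set (pt R n) := [set y | (edist c y < r)%R].
Definition eopen (O : set (pt R n)) : Prop :=
  forall x, O x -> exists2 r : R, (0 < r)%R & eball x r `<=` O.

Definition wmeas (w : pt R n -> R) (E : set (pt R n)) : \bar R :=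
  \int[@leb R n]_(x in E) (w x)%:E.

Definition weight (w : pt R n -> R) : Prop :=
  (forall x, (0 <= w x)%R) /\ measurable_fun setT w /\
  (forall c r, wmeas w (eball c r) < +oo).

Definition wneg (q : R) (w : pt R n -> R) (x : pt R n) : \bar R :=
  let q' := (q / (q - 1))%R in
  if w x == 0%R then +oo else ((w x) `^ (- (q' / q)))%:E.

Definition Aq (q : R) (w : pt R n -> R) : Prop :=
  weight w /\
  exists C : R, forall (c : pt R n) (r : R), (0 < r)%R ->
    poweR (@leb R n (eball c r)) (- q) * wmeas w (eball c r) *
    poweR (\int[@leb R n]_(x in eball c r) wneg q w x) (q - 1) <= C%:E.

Definition maxfun (w : pt R n -> R) (x : pt R n) : \bar R :=
  ereal_sup [set y | exists c r, (0 < r)%R /\ eball c r x /\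
     y = (fine (@leb R n (eball c r)))^-1%:E * wmeas w (eball c r)].

Definition A1 (w : pt R n -> R) : Prop :=
  weight w /\
  exists C : R, {ae @leb R n, forall x, maxfun w x <= C%:E * (w x)%:E}.

Definition Ainf (w : pt R n -> R) : Prop :=
  A1 w \/ exists q : R, (1 < q)%R /\ Aq q w.

(** 1/p with the convention 1/oo := 0 *)
Definition inv_ext (x : \bar R) : R :=
  match x with r%:E => r^-1 | _ => 0%R end.

Definition log_holder_decay (O : set (pt R n)) (p : pt R n -> \bar R)
    (pinf : \bar R) : Prop :=
  exists2 c2 : R, (0 < c2)%R & forall x, O x ->
    (`|inv_ext (p x) - inv_ext pinf| <= c2 / ln (expR 1 + enorm x))%R.

End Euclid.

(** lambda^{1/t}, with lambda^{1/0} := 0 *)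
Definition lampow (R : realType) (lam t : R) : R :=
  if t == 0 then 0 else lam `^ t^-1.

(* Main.v *)
Require Import Defs.
From HB Require Import structures.
From mathcomp Require Import all_boot all_order all_algebra.
From mathcomp Require Import all_classical all_reals all_analysis.
From mathcomp Require Import measurable_realfun.
From mathcomp Require Import lra ring.
Set Implicit Arguments. Unset Strict Implicit. Unset Printing Implicit Defensive.
Import Order.TTheory GRing.Theory Num.Theory.
Local Open Scope classical_set_scope.
Local Open Scope ring_scope.

(* An A_oo weight grows polynomially on balls about the origin:
   w(B(0,r)) <= K r^M for r >= 1. For A_1, average the bound Mw <= C w over
   B(0,1); for A_q, the A_q condition on B(0,r) bounds w(B(0,r)) by
   C |B(0,r)|^q / sigma(B(0,1))^(q-1), where sigma = w^(-q'/q) and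
   sigma(B(0,1)) > 0. Take lambda = exp(-c2 (M+1)) with c2 the log-Hoelder
   constant and k = floor(ln(e+|x|)): the decay condition gives
   lambda^(1/|1/p(x) - 1/p_oo|) <= exp(-(M+1) k) while |x| < e^(k+1), so the
   integrand is dominated by sum_k exp(-(M+1) k) 1_{B(0,e^(k+1))} w, whose
   integral is at most sum_k K e^M e^(-k) < oo. *)

Section ge0_integral_bounds.
Local Open Scope ereal_scope.
Context d (T : measurableType d) (R : realType) (mu : {measure set T -> \bar R}).

Lemma le_ge0_integral (D : set T) (f g : T -> \bar R) :
  (forall x, D x -> 0 <= f x) -> (forall x, D x -> f x <= g x) ->
  \int[mu]_(x in D) f x <= \int[mu]_(x in D) g x.
Proof.
move=> f0 fg; have g0 x : D x -> 0 <= g x.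
  by move=> Dx; exact: le_trans (f0 _ Dx) (fg _ Dx).
rewrite (ge0_integralE _ f0) (ge0_integralE _ g0).
apply: ereal_sup_le => _ [h hf <-].
exists h => //= x; apply: le_trans (hf x) _; rewrite /patch.
by case: ifPn => // /set_mem /fg.
Qed.

Lemma ge0_integral_le_nneseries (A : nat -> set T) (c : nat -> R)
    (w : T -> R) (D : set T) (F : T -> R) :
  (forall k, measurable (A k)) -> (forall k, (0 <= c k)%R) ->
  (forall x, (0 <= w x)%R) -> measurable_fun setT w ->
  (forall x, D x -> (0 <= F x)%R) ->
  (forall x, D x -> exists k, (F x <= c k * w x)%R /\ A k x) ->
  \int[mu]_(x in D) (F x)%:E <=
    \sum_(k <oo) (c k)%:E * \int[mu]_(x in A k) (w x)%:E.
Proof.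
move=> mA c0 w0 mw F0 FA.
pose g k x := (c k * (\1_(A k) x * w x))%:E.
have g0 k x : 0 <= g k x by rewrite lee_fin !mulr_ge0.
have mg k : measurable_fun setT (g k).
  apply/measurable_EFinP/measurable_funM => //.
  exact/measurable_funM/mw/measurable_indic.
have gE k : \int[mu]_x g k x = (c k)%:E * \int[mu]_(x in A k) (w x)%:E.
  rewrite -ge0_integralZl_EFin//; last 2 first.
  - by move=> x _; rewrite lee_fin.
  - exact/measurable_EFinP/measurable_funTS.
  rewrite [RHS]integral_mkcond; apply: eq_integral => x _.
  by rewrite /g /patch indicE; case: ifPn; rewrite ?mul1r ?mul0r ?mulr0.
rewrite (eq_eseriesr (fun k _ => esym (gE k))).
rewrite -integral_nneseries// integral_mkcond.
apply: le_ge0_integral => x _; rewrite /patch;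
  case: ifPn => [/set_mem Dx|_]; rewrite ?lee_fin ?F0 ?nneseries_ge0//.
have [k [Fk Akx]] := FA x Dx.
apply: le_trans (nneseries_lim_ge (u_ := g^~ x) k.+1 (fun i _ _ => g0 i x)).
rewrite big_nat_recr//= lee_paddl ?sume_ge0//.
by rewrite /g lee_fin indicE mem_set// mul1r.
Qed.

Lemma integral_gt0 (D : set T) (f : T -> \bar R) : measurable D ->
  measurable_fun D f -> (forall x, D x -> 0 < f x) -> 0 < mu D ->
  0 < \int[mu]_(x in D) f x.
Proof.
move=> mD mf f0 muD0; rewrite lt0e integral_ge0 ?andbT; last by move=> x /f0/ltW.
apply/negP => /eqP intf0.
have : \int[mu]_(x in D) `|f x| = 0.
  rewrite -intf0; apply: eq_integral => x /set_mem Dx.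
  by rewrite gee0_abs// ltW// f0.
move=> /(ae_eq_integral_abs _ mD mf)[N [mN N0 DN]].
suff : mu D <= 0 by rewrite leNgt muD0.
rewrite -N0 le_measure ?inE// => x Dx; apply: DN => /(_ Dx) fx0.
by have := f0 x Dx; rewrite fx0 ltxx.
Qed.

End ge0_integral_bounds.

Section origin_balls.
Context {R : realType}.

Fixpoint origin (n : nat) : pt R n :=
  match n return pt R n with 0 => tt | m.+1 => (0, origin m) end.

Lemma sqnorm_ge0 n (x : pt R n) : 0 <= sqnorm x.
Proof. by elim: n x => [//|n IH] x; rewrite addr_ge0 ?sqr_ge0. Qed.

Lemma measurable_sqnorm n : measurable_fun setT (@sqnorm R n).
Proof.
elim: n => [|n IH]; first exact: measurable_cst.
apply: measurable_funD; first by apply: measurable_funX; exact: measurable_fst.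
exact: measurableT_comp IH measurable_snd.
Qed.

Lemma sqnorm_vsub0 n (x : pt R n) : sqnorm (vsub (origin n) x) = sqnorm x.
Proof. by elim: n x => [//|n IH] x /=; rewrite IH sub0r sqrrN. Qed.

Definition ball0 n (r : R) : set (pt R n) := eball (origin n) r.
Arguments ball0 : clear implicits.

Lemma ball0E n (r : R) x : ball0 n r x = (enorm x < r).
Proof. by rewrite /ball0 /eball /Defs.edist /enorm /= sqnorm_vsub0. Qed.

Lemma ball0_sqnorm n (r : R) : 0 < r -> ball0 n r = [set x | sqnorm x < r ^+ 2].
Proof.
move=> r0; apply/funext => x; rewrite ball0E /enorm.
by rewrite -[X in (_ < X)](gtr0_norm r0) -sqrtr_sqr ltr_sqrt ?exprn_gt0.
Qed.

Lemma measurable_ball0 n (r : R) : 0 < r -> measurable (ball0 n r).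
Proof.
move=> r0; rewrite ball0_sqnorm// -[X in measurable X]setTI.
have -> : [set x | sqnorm x < r ^+ 2] = @sqnorm R n @^-1` `]-oo, r ^+ 2[.
  by apply/seteqP; split => x /=; rewrite in_itv.
exact: measurable_sqnorm.
Qed.

Lemma ball0_le n (r : R) s : r <= s -> ball0 n r `<=` ball0 n s.
Proof. by move=> rs x; rewrite !ball0E => /lt_le_trans; apply. Qed.

Definition cylinder n (s : R) (B : set (pt R n)) : set (pt R n.+1) :=
  `]-s, s[ `*` B.

Lemma ball0S_sub_cylinder n (r : R) :
  0 < r -> ball0 n.+1 r `<=` cylinder r (ball0 n r).
Proof.
move=> r0; rewrite /cylinder !ball0_sqnorm// => -[a x] /= ax.
have := @sqnorm_ge0 n x; have := sqr_ge0 a.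
rewrite in_itv /= !expr2 in ax * => a0 x0.
by split; [apply/andP; split|]; nra.
Qed.

Lemma cylinder_sub_ball0S n (r : R) :
  0 < r -> cylinder (r / 2) (ball0 n (r / 2)) `<=` ball0 n.+1 r.
Proof.
move=> r0; rewrite /cylinder !ball0_sqnorm ?divr_gt0// => -[a x] /= [].
rewrite in_itv /= => /andP[a1 a2] x2; rewrite !expr2 in x2 *; nra.
Qed.

Lemma measurable_cylinder n (s : R) (B : set (pt R n)) :
  measurable B -> measurable (cylinder s B).
Proof.
exact: (@measurableX _ _ (measurableTypeR R) (Rn R n) _ _ (measurable_itv _)).
Qed.

Lemma leb_cylinder n (s : R) (B : set (pt R n)) : 0 < s -> measurable B ->
  @leb R n.+1 (cylinder s B) = ((2 * s)%:E * @leb R n B)%E.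
Proof.
move=> s0 mB.
apply: (eq_trans (@product_measure1E _ _ _ _ R lebesgue_measure (@leb R n) _ _
  (measurable_itv _) mB)).
congr (_ * _)%E; apply: (eq_trans (lebesgue_measure_itv _)).
by rewrite /= lte_fin gtrN// -EFinD opprK -mulr2n mulr_natl.
Qed.

Lemma leb_ball0_le n (r : R) :
  0 < r -> (@leb R n (ball0 n r) <= ((2 * r) ^+ n)%:E)%E.
Proof.
elim: n r => [|n IH] r r0.
  by rewrite /leb /= diracE; case: (_ \in _); rewrite lee_fin ?ler01.
have mX := measurable_cylinder r (measurable_ball0 n r0).
have sub : (@leb R n.+1 (ball0 n.+1 r) <=
             @leb R n.+1 (cylinder r (ball0 n r)))%E.
  exact: le_measure (mem_set (measurable_ball0 _ r0)) (mem_set mX)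
    (ball0S_sub_cylinder r0).
apply: le_trans sub _.
rewrite leb_cylinder//; last exact: measurable_ball0.
rewrite (exprS (2 * r) n) (EFinM (2 * r)).
by apply: lee_pmul; rewrite ?IH ?measure_ge0// lee_fin mulr_ge0 ?ltW.
Qed.

Lemma leb_ball0_gt0 n (r : R) : 0 < r -> (0 < @leb R n (ball0 n r))%E.
Proof.
elim: n r => [|n IH] r r0.
  by rewrite /leb /= diracE mem_set ?lte_fin// ball0E /enorm sqrtr0.
have r2 : 0 < r / 2 by rewrite divr_gt0.
have mX := measurable_cylinder (r / 2) (measurable_ball0 n r2).
have sup : (@leb R n.+1 (cylinder (r / 2) (ball0 n (r / 2))) <=
             @leb R n.+1 (ball0 n.+1 r))%E.
  exact: le_measure (mem_set mX) (mem_set (measurable_ball0 _ r0))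
    (cylinder_sub_ball0S r0).
apply: lt_le_trans sup.
rewrite leb_cylinder//; last exact: measurable_ball0.
by rewrite mule_gt0 ?IH// lte_fin mulr_gt0.
Qed.

Definition ballvol n (r : R) : R := fine (@leb R n (ball0 n r)).

Lemma leb_ball0E n (r : R) : 0 < r -> @leb R n (ball0 n r) = (ballvol n r)%:E.
Proof.
move=> r0; rewrite fineK// ge0_fin_numE ?measure_ge0//.
exact: le_lt_trans (leb_ball0_le n r0) (ltry _).
Qed.

Lemma ballvol_gt0 n (r : R) : 0 < r -> 0 < ballvol n r.
Proof. by move=> r0; rewrite -lte_fin -leb_ball0E// leb_ball0_gt0. Qed.

Lemma ballvol_le n (r : R) : 0 < r -> ballvol n r <= (2 * r) ^+ n.
Proof. by move=> r0; rewrite -lee_fin -leb_ball0E// leb_ball0_le. Qed.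

End origin_balls.
Arguments ball0 {R} n r.

Section weight_growth.
Context {R : realType} {n : nat}.
Implicit Types (w : pt R n -> R) (q r : R).
Local Open Scope ereal_scope.

Lemma wmeas_ge0 w E : (forall x, 0 <= w x)%R -> 0 <= wmeas w E.
Proof. by move=> w0; apply: integral_ge0 => x _; rewrite lee_fin. Qed.

Lemma weight_wmeas_ball0E w r :
  weight w -> wmeas w (ball0 n r) = (fine (wmeas w (ball0 n r)))%:E.
Proof.
by case=> w0 [_ wfin]; rewrite fineK// ge0_fin_numE ?wmeas_ge0//; exact: wfin.
Qed.

Definition poly_growth w (K : R) (M : nat) : Prop :=
  forall r, (1 <= r)%R -> wmeas w (ball0 n r) <= (K * r ^+ M)%:E.

Lemma poly_growth_ballvol_powR w K q : (0 <= K)%R -> (0 <= q)%R ->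
    (forall r, (1 <= r)%R -> wmeas w (ball0 n r) <= (K * ballvol n r `^ q)%:E) ->
  exists K' M, (0 <= K')%R /\ poly_growth w K' M.
Proof.
move=> K0 q0 wle; set m := (Num.truncn q).+1.
exists (K * 2 ^+ (n * m))%R, (n * m)%N; split; first by rewrite mulr_ge0 ?exprn_ge0.
move=> r r1; apply: le_trans (wle r r1) _; rewrite lee_fin.
have r0 : (0 < r)%R by lra.
have r2n : (1 <= (2 * r) ^+ n)%R by rewrite exprn_ege1//; lra.
rewrite -mulrA ler_wpM2l// -exprMn exprM -powR_mulrn ?(le_trans ler01)//.
apply: (@le_trans _ _ (((2 * r) ^+ n) `^ q)%R).
  by rewrite ge0_ler_powR ?nnegrE ?(ballvol_le n r0) ?(ltW (ballvol_gt0 n r0))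
    ?(le_trans ler01 r2n).
by apply: ler_powR => //; exact/ltW/truncnS_gt.
Qed.

Lemma ball0_avg_le_maxfun w r x : (0 < r)%R -> ball0 n r x ->
  (ballvol n r)^-1%:E * wmeas w (ball0 n r) <= maxfun w x.
Proof. by move=> r0 Brx; apply: ereal_sup_ubound; exists (origin n), r. Qed.

Lemma A1_wmeas_ball0_le w : A1 w -> exists2 K : R, (0 <= K)%R &
  forall r, (1 <= r)%R -> wmeas w (ball0 n r) <= (K * ballvol n r)%:E.
Proof.
move=> [wt [C HC]]; have [w0 [mw _]] := wt.
pose C' := Num.max C 0%R; have C'0 : (0 <= C')%R by rewrite le_max lexx orbT.
pose W r := fine (wmeas w (ball0 n r)).
have W0 r : (0 <= W r)%R by rewrite fine_ge0 ?wmeas_ge0.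
have v10 := @ballvol_gt0 R n 1 ltr01; have mB1 := measurable_ball0 n (@ltr01 R).
exists (C' * W 1 / ballvol n 1)%R; first by rewrite divr_ge0 ?mulr_ge0// ltW.
move=> r r1; have r0 : (0 < r)%R by lra.
pose y := (W r / ballvol n r)%R.
have y0 : (0 <= y)%R by rewrite divr_ge0// ltW// ballvol_gt0.
have avg_le : {ae @leb R n, forall x, ball0 n 1 x -> y%:E <= (C' * w x)%:E}.
  apply: filterS HC => x Mx B1x; apply: le_trans (le_trans Mx _).
    rewrite /y mulrC EFinM -weight_wmeas_ball0E//.
    by apply: ball0_avg_le_maxfun r0 _; apply: ball0_le B1x.
  by rewrite EFinM lee_wpmul2r ?lee_fin ?le_max ?lexx.
have mCw : measurable_fun (ball0 n 1) (fun x => (C' * w x)%:E).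
  by apply/measurable_EFinP/measurable_funM => //; exact: measurable_funTS.
have := ae_ge0_le_integral mB1 (fun x _ => y0 : (0 <= y%:E)) (measurable_cst _)
  (fun x _ => mulr_ge0 C'0 (w0 x) : (0 <= (C' * w x)%:E)) mCw avg_le.
(* [integral_cst] reaches [leb] through another coercion path: fold it back. *)
rewrite integral_cst// -[X in y%:E * X]/(@leb R n (ball0 n 1)) leb_ball0E//.
under eq_integral do rewrite EFinM.
rewrite ge0_integralZl_EFin//; last 2 first.
- by move=> x _; rewrite lee_fin.
- exact/measurable_EFinP/measurable_funTS.
rewrite -/(wmeas w _) weight_wmeas_ball0E// -EFinM !lee_fin => yle.
have -> : wmeas w (ball0 n r) = (y * ballvol n r)%:E.
  by rewrite /y /W divfK ?gt_eqF ?ballvol_gt0//; exact: weight_wmeas_ball0E.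
rewrite lee_fin; apply: ler_wpM2r; first exact/ltW/ballvol_gt0.
by rewrite ler_pdivlMr.
Qed.

Lemma wneg_gt0 q w x : 0 < wneg q w x.
Proof.
by rewrite /wneg; case: ifPn => // wx0; rewrite lte_fin /powR (negbTE wx0) expR_gt0.
Qed.

Lemma measurable_wneg q w : measurable_fun setT w -> measurable_fun setT (wneg q w).
Proof.
move=> mw; apply: measurable_fun_ifT; first exact: measurable_fun_eqr.
  exact: measurable_cst.
by apply/measurable_EFinP; exact: measurableT_comp (measurable_powR _) mw.
Qed.

Lemma Aq_wmeas_ball0_le q w : (1 < q)%R -> Aq q w -> exists2 K : R, (0 <= K)%R &
  forall r, (1 <= r)%R -> wmeas w (ball0 n r) <= (K * ballvol n r `^ q)%:E.
Proof.
move=> q1 [wt [C HC]]; have [w0 [mw _]] := wt.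
pose sigma r := \int[@leb R n]_(x in ball0 n r) wneg q w x.
have sigma1_gt0 : 0 < sigma 1%R.
  apply: integral_gt0 => [||x _|]; first exact: measurable_ball0.
  - exact/measurable_funTS/measurable_wneg.
  - exact: wneg_gt0.
  - exact: leb_ball0_gt0.
have [s s0 s_le] : exists2 s : R, (0 < s)%R & s%:E <= sigma 1%R.
  move: sigma1_gt0; case: (sigma 1%R) => [s s0||//]; last first.
    by exists 1%R; rewrite ?leey.
  by exists s; rewrite -?lte_fin.
pose C' := Num.max C 0%R; have C'0 : (0 <= C')%R by rewrite le_max lexx orbT.
exists (C' / s `^ (q - 1))%R; first by rewrite divr_ge0// powR_ge0.
move=> r r1; have r0 : (0 < r)%R by lra.
have sigma_le : s%:E <= sigma r.
  apply: (le_trans s_le).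
  apply: (ge0_subset_integral _ (measurable_ball0 n ltr01) (measurable_ball0 n r0)).
  - exact/measurable_funTS/measurable_wneg.
  - by move=> x _; exact/ltW/wneg_gt0.
  - exact: ball0_le.
have := HC (origin n) r r0; rewrite -/(ball0 n r) -/(sigma r).
rewrite leb_ball0E// weight_wmeas_ball0E// poweR_EFin.
set W := fine (wmeas w (ball0 n r)); set v := ballvol n r => Aq_r.
have Aq_s : (v `^ (- q) * W * s `^ (q - 1) <= C)%R.
  rewrite -lee_fin; apply: le_trans Aq_r; rewrite !EFinM lee_wpmul2l//.
    by rewrite -EFinM lee_fin mulr_ge0 ?powR_ge0 ?fine_ge0 ?wmeas_ge0.
  rewrite -poweR_EFin; apply: gt0_ler_poweR; last exact: sigma_le.
  - by rewrite subr_ge0 ltW.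
  - by rewrite in_itv/= leey lee_fin ltW.
  - by rewrite in_itv/= leey andbT (le_trans _ sigma_le)// lee_fin ltW.
rewrite lee_fin mulrAC ler_pdivlMr ?powR_gt0//.
move: Aq_s; rewrite powRN mulrAC -mulrA ler_pdivrMl ?powR_gt0 ?ballvol_gt0//.
rewrite mulrC => /le_trans; apply; rewrite mulrC.
by apply: ler_wpM2r; rewrite ?powR_ge0// le_max lexx.
Qed.

Lemma Ainf_weight w : Ainf w -> weight w.
Proof. by case=> [[]|[q [_ []]]]. Qed.

Lemma Ainf_poly_growth w : Ainf w -> exists K M, (0 <= K)%R /\ poly_growth w K M.
Proof.
case=> [/A1_wmeas_ball0_le|[q [q1 /(Aq_wmeas_ball0_le q1)]]] [K K0 wle].
  apply: (@poly_growth_ballvol_powR _ K 1) => // r r1.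
  by rewrite powRr1 ?wle// ltW// ballvol_gt0// (lt_le_trans ltr01).
apply: (@poly_growth_ballvol_powR _ K q) => //; lra.
Qed.

End weight_growth.

Section log_decay.
Context {R : realType}.

Lemma lampow_ge0 (lam t : R) : 0 <= lam -> 0 <= lampow lam t.
Proof. by move=> lam0; rewrite /lampow; case: ifPn => // _; exact: powR_ge0. Qed.

Lemma lampow_expR_le (c t L : R) :
  0 <= t -> t * L <= c -> lampow (expR (- c)) t <= expR (- L).
Proof.
rewrite /lampow le_eqVlt => /predU1P[<-|t0] tLc; first by rewrite eqxx expR_ge0.
by rewrite gt_eqF// -expRM ler_expR mulNr lerN2 ler_pdivlMr// mulrC.
Qed.

Lemma ln_expR1D_ge1 (a : R) : 0 <= a -> 1 <= ln (expR 1 + a).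
Proof.
move=> a0; rewrite -[leLHS](@expRK R) ler_ln ?posrE ?lerDl ?expR_gt0//.
by rewrite ltr_wpDr ?expR_gt0.
Qed.

Lemma log_decay_shell n (x : pt R n) (c2 N t : R) : 0 <= N -> 0 <= t ->
    t <= c2 / ln (expR 1 + enorm x) ->
  exists k : nat,
    lampow (expR (- (c2 * N))) t <= expR (- (N * k%:R)) /\
    ball0 n (expR k.+1%:R) x.
Proof.
move=> N0 t0 tle; set L := ln (expR 1 + enorm x).
have e0 : 0 <= enorm x by exact: sqrtr_ge0.
have L1 : 1 <= L := ln_expR1D_ge1 e0.
exists (Num.truncn L); split.
  apply: (le_trans (lampow_expR_le t0 (_ : t * (N * L) <= c2 * N))).
    by rewrite mulrCA mulrC ler_wpM2r// -ler_pdivlMr// (lt_le_trans ltr01).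
  by rewrite ler_expR lerN2 ler_wpM2l// truncn_le (le_trans ler01).
rewrite ball0E; apply: (lt_trans (_ : _ < expR L)); last first.
  by rewrite ltr_expR truncnS_gt.
by rewrite lnK ?posrE ?ltr_pwDl ?expR_gt0// addr_gt0 ?expR_gt0.
Qed.

Local Open Scope ereal_scope.

Lemma nneseries_geometric_lty (a z : R) : (0 <= a)%R -> (0 < z < 1)%R ->
  \sum_(k <oo) (a * z ^+ k)%:E < +oo.
Proof.
move=> a0 /andP[z0 z1].
apply: (@le_lt_trans _ _ (a * (1 - z)^-1)%:E); last exact: ltry.
apply: lime_le.
  by apply: is_cvg_nneseries => k _ _; rewrite lee_fin mulr_ge0// exprn_ge0// ltW.
apply: nearW => m; rewrite sumEFin lee_fin.
by apply: geometric_le_lim => //; rewrite ger0_norm// ltW.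
Qed.

Lemma poly_growth_nneseries_lty n (w : pt R n -> R) (K : R) (M : nat) :
    (forall x, 0 <= w x)%R -> (0 <= K)%R -> poly_growth w K M ->
  \sum_(k <oo) (expR (- (M.+1%:R * k%:R)))%:E * wmeas w (ball0 n (expR k.+1%:R))
    < +oo.
Proof.
move=> w0 K0 growth.
have e1 : (0 < expR (-1 : R) < 1)%R by rewrite expR_gt0 expR_lt1 ltrN10.
apply: le_lt_trans (nneseries_geometric_lty (mulr_ge0 K0 (expR_ge0 M%:R)) e1).
apply: lee_nneseries => [k _ _|k _].
  by rewrite mule_ge0 ?lee_fin ?expR_ge0 ?wmeas_ge0.
have ek1 : (1 <= expR k.+1%:R :> R)%R.
  by rewrite (le_trans _ (expR_ge1Dx _)) ?lerDl.
apply: le_trans (lee_wpmul2l _ (growth _ ek1)) _; first by rewrite lee_fin expR_ge0.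
rewrite -EFinM lee_fin mulrCA -!expRM_natr -mulrA -!expRD; apply: (ler_wpM2l K0).
by rewrite ler_expR -!natr1 le_eqVlt; apply/orP; left; apply/eqP; ring.
Qed.

End log_decay.

Theorem lemma5p6 (R : realType) (n : nat) (Omega : set (pt R n))
    (w : pt R n -> R) (p : pt R n -> \bar R) (pinf : \bar R) :
  eopen Omega ->
  Ainf w ->
  measurable_fun Omega p ->
  (forall x, Omega x -> (1 <= p x)%E) ->
  (1 <= pinf)%E ->
  log_holder_decay Omega p pinf ->
  exists2 lam : R, 0 < lam < 1 &
    (\int[@leb R n]_(x in Omega)
        (lampow lam `|inv_ext (p x) - inv_ext pinf| * w x)%:E < +oo)%E.
Proof.
move=> _ Aw _ _ _ [c2 c20 decay].
have [w0 [mw _]] := Ainf_weight Aw.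
have [K [M [K0 growth]]] := Ainf_poly_growth Aw.
exists (expR (- (c2 * M.+1%:R))).
  by rewrite expR_gt0 expR_lt1 oppr_lt0 mulr_gt0.
apply: le_lt_trans (poly_growth_nneseries_lty w0 K0 growth).
apply: ge0_integral_le_nneseries => // [k|x _|x Ox].
- exact: measurable_ball0 (expR_gt0 _).
- by rewrite mulr_ge0 ?lampow_ge0 ?expR_ge0.
have [k [lam_le Bx]] := log_decay_shell (ler0n _ M.+1) (normr_ge0 _) (decay x Ox).
by exists k; split => //; rewrite ler_wpM2r.
Qed.
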